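(* If $N_1,N_2,N_3$ are feasible perfect negators, then $G=\operatorname{NNN}(N_1,N_2,N_3)$ is a bicritical snark.
   Context: A multipole consists of vertices and edges; each edge has two ends, each either at a vertex or free (a semiedge); all multipoles are cubic. Let $\mathbb{K}=\{(0,1),(1,0),(1,1)\}\subset\mathbb{Z}_2\times\mathbb{Z}_2$. A colouring of a multipole assigns elements of $\mathbb{K}$ to edges so that the three edge ends at each vertex get distinct colours. A snark is a connected cubic graph with no colouring. For distinct vertices $x,y$ of a graph $G$, $G-\{x,y\}$ is the multipole obtained by deleting $x,y$ (edges to other vertices become dangling edges; an edge $xy$, if present, is kept as an isolated edge). A snark is bicritical if $G-\{x,y\}$ is colourable for all distinct vertices $x,y$. Negator: for a snark $H$ of girth at least $5$ and a path $uwv$ in $H$, $N=\operatorname{Neg}(H;u,v)$ is the $(2,2,1)$-pole $N(I,O,r)$ obtained by deleting $u,w,v$, with $I=\{i_1,i_2\}$ the semiedges formerly at $u$, $O=\{o_1,o_2\}$ those formerly at $v$, and $r$ the one formerly at $w$. $N$ is perfect if the set of tuples $(\varphi(i_1),\varphi(i_2),\varphi(o_1),\varphi(o_2),\varphi(r))$ over its colourings equals $\{(z,z,a,b,a+b),(a,b,z,z,a+b): z,a,b\in\mathbb{K}, a\ne b\}$. $N$ is feasible if (0) $H-\{x,y\}$ is colourable for all distinct $x,y\in V(N)$; (i) for every $x\in\{u,v\}$ and $y\in V(N)$ and any two dangling edges $e,f$ of the $6$-pole $H-\{x,y\}$ formerly incident with $x$, there is a colouring $\varphi$ of $H-\{x,y\}$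 with $\varphi(e)=\varphi(f)$; (ii) for every vertex $y\in V(N)$ there exist colourings $\varphi,\psi$ of the $8$-pole $N-y$ (delete $y$, its edges become dangling) with $\varphi(i_1,i_2,o_1,o_2,r)=(a,a,b,b,a)$ and $\psi(i_1,i_2,o_1,o_2,r)=(a,a,b,b,b)$ for some $a,b\in\mathbb{K}$ with $a\ne b$. For negators $N_j(I_j,O_j,r_j)$, $j=1,2,3$, $\operatorname{NNN}(N_1,N_2,N_3)$ is the cubic graph obtained by performing the junctions (identifying free ends in pairs along arbitrary bijections) of $O_1$ with $I_2$, $O_2$ with $I_3$, $O_3$ with $I_1$, and adding a new vertex incident with $r_1,r_2,r_3$. *)

(* Defs.v *)
From HB Require Import structures.
From mathcomp Require Import all_boot all_algebra.
Unset Printing Implicit Defensive.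
Import GRing.Theory.
Local Open Scope ring_scope.

Definition col : Type := ('Z_2 * 'Z_2)%type.
Definition inK (c : col) : bool := c != 0.

(* ---------- multipoles ----------
   A multipole has a finite vertex type and a finite edge type; every edge has
   two ends (indexed by bool), each either at a vertex (Some x) or free (None). *)
Record multipole := Multipole {
  mV : finType;
  mE : finType;
  mends : mE -> bool -> option mV }.

Definition incident (M : multipole) (e : mE M) (x : mV M) : bool :=
  [exists b : bool, mends M e b == Some x].
Arguments incident {M} e x.

Definition colouring (M : multipole) (phi : mE M -> col) : Prop :=
  (forall e, inK (phi e)) /\
  (forall (x : mV M) (e f : mE M) (b c : bool),
      (e, b) != (f, c) -> mends M e b = Some x -> mends M f c = Some x ->
      phi e != phi f).

Definition colourable (M : multipole) : Prop := exists phi, colouring M phi.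

Definition cubic (M : multipole) : Prop :=
  forall x : mV M, #|[set d : mE M * bool | mends M d.1 d.2 == Some x]| = 3.

Definition no_free_ends (M : multipole) : Prop :=
  forall (e : mE M) (b : bool), mends M e b != None.

Definition cubic_graph (M : multipole) : Prop := cubic M /\ no_free_ends M.

Definition adj (M : multipole) : rel (mV M) :=
  fun x y => [exists e : mE M, exists b : bool,
                (mends M e b == Some x) && (mends M e (~~ b) == Some y)].

Definition connected (M : multipole) : Prop :=
  forall x y : mV M, connect (adj M) x y.

Definition snark (M : multipole) : Prop :=
  cubic_graph M /\ connected M /\ ~ colourable M.

(* deletion of a set of vertices: ends at deleted vertices become free; every
   edge is kept (an edge between deleted vertices becomes an isolated edge) *)
Definition delete (M : multipole) (S : {set mV M}) : multipole :=
  @Multipole {x : mV M | x \notin S} (mE M)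
    (fun e b => obind (fun x => insub x) (mends M e b)).

Definition bicritical_snark (M : multipole) : Prop :=
  snark M /\
  forall x y : mV M, x != y -> colourable (delete M [set x; y]).

Definition girth_ge5 (M : multipole) : Prop :=
  (forall e : mE M, mends M e true != mends M e false) /\
  (forall e f : mE M, e != f ->
     ~~ [exists b : bool, (mends M e b == mends M f true) &&
                          (mends M e (~~ b) == mends M f false)]) /\
  (forall a b c : mV M, uniq [:: a; b; c] ->
     ~ [/\ adj M a b, adj M b c & adj M c a]) /\
  (forall a b c d : mV M, uniq [:: a; b; c; d] ->
     ~ [/\ adj M a b, adj M b c, adj M c d & adj M d a]).

(* ---------- negators ----------
   Data of Neg(H;u,v) for a path u w v, together with the labelling of the
   semiedges: i1,i2 formerly at u, o1,o2 formerly at v, r formerly at w. *)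
Record negdata := NegData {
  nH : multipole;
  nu : mV nH; nw : mV nH; nv : mV nH;
  ni1 : mE nH; ni2 : mE nH; no1 : mE nH; no2 : mE nH; nr : mE nH }.

Definition nD (N : negdata) : {set mV (nH N)} := [set nu N; nw N; nv N].

Definition is_negator (N : negdata) : Prop :=
  let H := nH N in
  [/\ snark H, girth_ge5 H, uniq [:: nu N; nw N; nv N],
      adj H (nu N) (nw N) & adj H (nw N) (nv N)] /\
  [/\ ni1 N != ni2 N, incident (ni1 N) (nu N), incident (ni2 N) (nu N),
      ~~ incident (ni1 N) (nw N) & ~~ incident (ni2 N) (nw N)] /\
  [/\ no1 N != no2 N, incident (no1 N) (nv N), incident (no2 N) (nv N),
      ~~ incident (no1 N) (nw N) & ~~ incident (no2 N) (nw N)] /\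
  [/\ incident (nr N) (nw N), ~~ incident (nr N) (nu N)
    & ~~ incident (nr N) (nv N)].

(* the (2,2,1)-pole N = H - {u,w,v} (the edges uw, wv survive only as isolated
   edges, which do not influence colourings) *)
Definition negpole (N : negdata) : multipole := delete (nH N) (nD N).

Definition sig5 (N : negdata) (phi : mE (nH N) -> col) :=
  (phi (ni1 N), phi (ni2 N), phi (no1 N), phi (no2 N), phi (nr N)).

Definition perfect_set (t : col * col * col * col * col) : Prop :=
  exists z a b : col, [/\ inK z, inK a, inK b, a != b &
    (t = (z, z, a, b, a + b) \/ t = (a, b, z, z, a + b))].

Definition perfect (N : negdata) : Prop :=
  forall t : col * col * col * col * col,
    (exists phi, colouring (negpole N) phi /\ sig5 N phi = t) <-> perfect_set t.

Definition feasible (N : negdata) : Prop :=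
  let H := nH N in
  (forall x y : mV (negpole N), x != y ->
     colourable (delete H [set val x; val y])) /\
  (forall (x : mV H) (y : mV (negpole N)), x \in [set nu N; nv N] ->
   forall e f : mE H, e != f ->
     incident e x -> ~~ incident e (val y) ->
     incident f x -> ~~ incident f (val y) ->
     exists phi, colouring (delete H [set x; val y]) phi /\ phi e = phi f) /\
  (forall y : mV (negpole N),
     exists a b : col, [/\ inK a, inK b, a != b,
       (exists phi, colouring (delete (negpole N) [set y]) phi /\
                    sig5 N phi = (a, a, b, b, a)) &
       (exists psi, colouring (delete (negpole N) [set y]) psi /\
                    sig5 N psi = (a, a, b, b, b))]).

Definition NV (N : negdata) : finType := mV (negpole N).

Definition inD (N : negdata) (o : option (mV (nH N))) : bool :=
  if o is Some x then x \in nD N else false.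

(* edges of H_j surviving in G: those with an end outside {u,w,v}, except the
   two edges of I_j (each I_j edge is merged into the O_{j-1} edge it is
   joined with) *)
Definition keepE (N : negdata) (e : mE (nH N)) : bool :=
  [&& [exists b : bool, ~~ inD N (mends (nH N) e b)], e != ni1 N & e != ni2 N].

Definition KE (N : negdata) : finType := {e : mE (nH N) | keepE N e}.

Definition other_end (M : multipole) (e : mE M) (x : mV M) : option (mV M) :=
  if mends M e true == Some x then mends M e false else mends M e true.
Arguments other_end {M} e x.

(* the bijection O(N) -> I(Nn) used in the junction, chosen by s *)
Definition partner (N Nn : negdata) (s : bool) (e : mE (nH N)) : mE (nH Nn) :=
  if e == no1 N then (if s then ni2 Nn else ni1 Nn)
  else (if s then ni1 Nn else ni2 Nn).

Definition comp_end (VG : Type) (N Nn : negdata) (s : bool)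
  (inj : NV N -> VG) (injn : NV Nn -> VG) (c : VG)
  (e : mE (nH N)) (b : bool) : option VG :=
  match mends (nH N) e b with
  | None => None
  | Some x =>
      if x == nw N then Some c
      else if x == nv N then
        omap injn (obind (fun y => insub y : option (NV Nn))
                     (other_end (partner N Nn s e) (nu Nn)))
      else omap inj (insub x : option (NV N))
  end.

Definition NNN (N1 N2 N3 : negdata) (s1 s2 s3 : bool) : multipole :=
  @Multipole (option (NV N1 + NV N2 + NV N3)%type) (KE N1 + KE N2 + KE N3)%type
    (fun e b =>
       let j1 := fun x : NV N1 => Some (inl (inl x)) : option (NV N1 + NV N2 + NV N3) in
       let j2 := fun x : NV N2 => Some (inl (inr x)) : option (NV N1 + NV N2 + NV N3) in
       let j3 := fun x : NV N3 => Some (inr x) : option (NV N1 + NV N2 + NV N3) in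
       match e with
       | inl (inl e1) => comp_end _ N1 N2 s1 j1 j2 None (val e1) b
       | inl (inr e2) => comp_end _ N2 N3 s2 j2 j3 None (val e2) b
       | inr e3 => comp_end _ N3 N1 s3 j3 j1 None (val e3) b
       end).

(* Main.v *)
From mathcomp Require Import all_boot perm all_algebra.
Require Import Defs.

Set Implicit Arguments.
Unset Strict Implicit.
Import GRing.Theory.
Local Open Scope ring_scope.

(** A perfect negator turns an equal pair of colours on one side into an unequal
    pair on the other, and three negations around a cycle are contradictory, so
    NNN has no colouring. For bicriticality one colours the three negators
    separately and matches the colours along the junctions. If both deleted
    vertices x, y lie in one negator, a colouring of H - {x, y} has unequal pairs
    on both sides, which the other two, perfect, negators can absorb. If the
    centre is deleted along with a vertex of a negator, condition (ii) provides
    equal pairs on both sides. If x lies in N1 and y in N2, condition (i) for v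
    and x gives N1 an unequal I-pair and an equal O-pair, while (ii) gives N2 two
    equal pairs together with the colour on r that makes the centre proper. NNN
    is connected because each component of a perfect negator contains the end
    of r. *)

(** * The three colours as nonzero elements of the Klein four-group *)

Local Notation c01 := ((0, 1) : col).
Local Notation c10 := ((1, 0) : col).
Local Notation c11 := ((1, 1) : col).

Lemma inKP (c : col) : inK c -> [\/ c = c01, c = c10 | c = c11].
Proof.
case: c => [[[|[|//]] p] [[|[|//]] q]] // _.
- by apply: Or31; congr pair; apply: val_inj.
- by apply: Or32; congr pair; apply: val_inj.
- by apply: Or33; congr pair; apply: val_inj.
Qed.

(** The three nonzero elements of the Klein four-group sum to zero. This recovers the third colour
    at a vertex from the other two. *)
Lemma inK_third (a b c : col) :
  inK a -> inK b -> inK c -> a != b -> a != c -> b != c -> a + b = c.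
Proof.
by move=> /inKP[]-> /inKP[]-> /inKP[]-> => // _ _ _; apply/eqP.
Qed.

Lemma inK_avoid (a : col) : inK a -> exists2 b, inK b & a != b.
Proof. by move=> /inKP[]->; [exists c10|exists c11|exists c01]. Qed.

(** * Edge ends, and colourings that are proper off a set of vertices *)

Definition darts (M : multipole) (x : mV M) : {set mE M * bool} :=
  [set d : mE M * bool | mends M d.1 d.2 == Some x].

Lemma in_darts (M : multipole) (x : mV M) e b :
  ((e, b) \in darts x) = (mends M e b == Some x).
Proof. by rewrite inE. Qed.

(** Deletion keeps every edge, so colourings of all deletions of [M] can live on the edge set of
    [M]; only the set [A] of vertices where properness is waived varies. Nested deletions then
    become unions of sets. *)
Definition colouring_off (M : multipole) (A : {set mV M}) (phi : mE M -> col) :=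
  (forall e, inK (phi e)) /\
  (forall x, x \notin A -> {in darts x &, injective (fun d => phi d.1)}).

Lemma colouring_off_sub (M : multipole) (A B : {set mV M}) phi :
  A \subset B -> colouring_off A phi -> colouring_off B phi.
Proof.
move=> AB [? h]; split=> // x xB; apply: h.
by apply: contra xB; apply: (subsetP AB).
Qed.

Lemma colouring_off0 (M : multipole) phi :
  colouring M phi <-> colouring_off (set0 : {set mV M}) phi.
Proof.
split=> -[h1 h2]; split=> //.
  move=> x _ [e b] [f c]; rewrite !in_darts /= => /eqP eb /eqP fc E.
  by apply/eqP/negPn/negP => N; move: (h2 _ _ _ _ _ N eb fc); rewrite E eqxx.
move=> x e f b c N eb fc; apply: contraNneq N => E; apply/eqP.
by apply: (h2 x); rewrite ?inE //= ?eb ?fc.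
Qed.

Lemma mends_delete (M : multipole) (S : {set mV M}) e b
    (x : mV (delete M S)) :
  (mends (delete M S) e b == Some x) = (mends M e b == Some (val x)).
Proof.
rewrite /=; case: (mends M e b) => //= y.
case: insubP => [z zS <-|yS]; last first.
  by apply/esym/negP => /eqP[E]; case/negP: yS; rewrite E; exact: (valP x).
by apply/eqP/eqP => [[->]|[/val_inj->]].
Qed.

Lemma colouring_off_delete (M : multipole) (D : {set mV M})
    (S : {set mV (delete M D)}) phi :
  @colouring_off (delete M D) S phi <-> colouring_off (D :|: val @: S) phi.
Proof.
have dE (x : mV (delete M D)) : darts x = darts (M := M) (val x).
  apply/setP=> d; rewrite [LHS]inE [RHS]inE; exact: mends_delete.
split=> -[h1 h2]; split=> //.
  move=> x; rewrite inE negb_or => /andP[xD xS].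
  have := h2 (Sub x xD); rewrite dE; apply.
  by apply: contra xS => xS; apply/imsetP; exists (Sub x xD).
move=> x xS; rewrite dE; apply: h2; rewrite inE negb_or (valP x) /=.
by rewrite (mem_imset _ _ val_inj).
Qed.

Lemma colouring_delete (M : multipole) (S : {set mV M}) phi :
  colouring (delete M S) phi <-> colouring_off S phi.
Proof.
apply: (iff_trans (colouring_off0 _)).
by have := colouring_off_delete (set0 : {set mV (delete M S)}) phi; rewrite imset0 setU0.
Qed.

Lemma colouring_delete1 (M : multipole) (D : {set mV M})
    (y : mV (delete M D)) phi :
  colouring (delete (delete M D) [set y]) phi
    <-> colouring_off (D :|: [set val y]) phi.
Proof.
apply: (iff_trans (@colouring_delete (delete M D) [set y] phi)).
by have := colouring_off_delete [set y] phi; rewrite imset_set1.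
Qed.

Lemma colouring_off_comp (M : multipole) (A : {set mV M}) phi (f : col -> col) :
  injective f -> (forall c, inK c -> inK (f c)) ->
  colouring_off A phi -> colouring_off A (f \o phi).
Proof.
move=> fi fK [h1 h2]; split=> [e|x xA d d' dx dx' /= /fi]; first exact: fK.
exact: h2 xA d d' dx dx'.
Qed.

(** First swap [a] with [c], then swap the image of [b] with [d]; the second swap fixes [c], because
    neither of its two colours is [c]. Only nonzero elements are moved. *)
Lemma col_perm2 (a b c d : col) :
  inK a -> inK b -> inK c -> inK d -> a != b -> c != d ->
  exists f : col -> col,
    [/\ injective f, forall c, inK c -> inK (f c), f a = c & f b = d].
Proof.
move=> Ka Kb Kc Kd ab cd.
exists (fun x => tperm (tperm a c b) d (tperm a c x)).
have bc : tperm a c b != c.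
  by apply: contra_neq ab => /(canRL (tpermK _ _)); rewrite tpermR.
have Kt (x y z : col) : inK x -> inK y -> inK z -> inK (tperm x y z).
  by move=> ? ? ?; case: tpermP => // ->.
split; [by move=> x y /perm_inj/perm_inj|..].
- by move=> x Kx; apply: (Kt) => //; apply: (Kt).
- by rewrite tpermL tpermD // eq_sym.
- by rewrite tpermL.
Qed.

(** * Incidence and adjacency in multipoles *)

Lemma incidentP (M : multipole) (e : mE M) (x : mV M) :
  reflect (exists b, mends M e b = Some x) (incident e x).
Proof.
by apply: (iffP existsP) => -[b /eqP h]; exists b => //; apply/eqP.
Qed.

Lemma mends_incident (M : multipole) (e : mE M) b x :
  mends M e b = Some x -> incident e x.
Proof. by move=> h; apply/incidentP; exists b. Qed.

Lemma colouring_off_neq (M : multipole) (A : {set mV M}) phi x e f :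
  colouring_off A phi -> x \notin A -> incident e x -> incident f x -> e != f ->
  phi e != phi f.
Proof.
move=> [_ h] xA /incidentP[b eb] /incidentP[c fc]; apply: contra_neq => E.
by have := h x xA (e, b) (f, c); rewrite !inE /= eb fc eqxx => /(_ isT isT E)[].
Qed.

(** Three distinct edges at [x] supply three distinct darts, which by cubicity are all the darts
    there. *)
Lemma cubic_incident (M : multipole) (x : mV M) (e1 e2 e3 e : mE M) :
  cubic M -> uniq [:: e1; e2; e3] ->
  incident e1 x -> incident e2 x -> incident e3 x -> incident e x ->
  e \in [:: e1; e2; e3].
Proof.
move=> cM U /incidentP[b1 h1] /incidentP[b2 h2] /incidentP[b3 h3].
move=> /incidentP[b h].
have U' : uniq [:: (e1, b1); (e2, b2); (e3, b3)].
  by apply: (@map_uniq _ _ fst).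
have S : [set d in [:: (e1, b1); (e2, b2); (e3, b3)]] \subset darts x.
  by apply/subsetP=> d; rewrite !inE => /or3P[]/eqP->; apply/eqP.
have /eqP E : [set d in [:: (e1, b1); (e2, b2); (e3, b3)]] == darts x.
  by rewrite eqEcard S cM cardsE (card_uniqP U').
have : (e, b) \in darts x by rewrite inE; apply/eqP.
by rewrite -E inE => /(map_f fst).
Qed.

Lemma adj_sym (M : multipole) (x y : mV M) : adj M x y = adj M y x.
Proof.
suff h a b : adj M a b -> adj M b a by apply/idP/idP; apply: h.
case/existsP=> e /existsP[c /andP[h1 h2]].
by apply/existsP; exists e; apply/existsP; exists (~~ c); rewrite negbK h1 h2.
Qed.

Lemma adjP (M : multipole) (x y : mV M) :
  reflect (exists e b, mends M e b = Some x /\ mends M e (~~ b) = Some y)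
          (adj M x y).
Proof.
apply: (iffP existsP) => -[e].
  by case/existsP=> b /andP[/eqP? /eqP?]; exists e, b.
by case=> b [/eqP? /eqP?]; exists e; apply/existsP; exists b; apply/andP.
Qed.

Lemma incident_both (M : multipole) (e : mE M) (x y : mV M) :
  x != y -> incident e x -> incident e y ->
  exists b, mends M e b = Some x /\ mends M e (~~ b) = Some y.
Proof.
move=> xy /incidentP[b eb] /incidentP[c ec]; exists b; split=> //.
suff -> : ~~ b = c by [].
by case: b c eb ec => -[] // -> [] /eqP; rewrite (negPf xy).
Qed.

Lemma incident_adj (M : multipole) (e : mE M) (x y : mV M) :
  x != y -> incident e x -> incident e y -> adj M x y.
Proof. by move=> xy ex ey; apply/adjP; exists e; apply: incident_both. Qed.

Lemma incident_ends (M : multipole) (e : mE M) (x y z : mV M) :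
  x != y -> incident e x -> incident e y -> incident e z -> (z == x) || (z == y).
Proof.
move=> xy /incidentP[b eb] /incidentP[c ec] /incidentP[d ed].
have [bd|bd] := eqVneq d b.
  by move: ed; rewrite bd eb => -[->]; rewrite eqxx.
have [cd|cd] := eqVneq d c.
  by move: ed; rewrite cd ec => -[->]; rewrite eqxx orbT.
by case: b c d bd cd eb ec {ed} => -[] [] // _ _ -> [] /eqP; rewrite (negPf xy).
Qed.

(** * Local structure of a negator around the path u, w, v *)

Section Negator.
Variables (N : negdata) (hN : is_negator N).
Local Notation H := (nH N).
Local Notation u := (nu N).
Local Notation w := (nw N).
Local Notation v := (nv N).

Lemma neg_cubic : cubic H.
Proof. by case: hN => -[[[]]]. Qed.

Lemma neg_connected : connected H.
Proof. by case: hN => -[[_ []]]. Qed.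

Lemma neg_end e b : exists x, mends H e b = Some x.
Proof.
case: hN => -[[[_ /(_ e b) h] _] _ _ _ _] _; move: h.
by case: (mends H e b) => // x; exists x.
Qed.

(** The girth condition excludes loops. *)
Lemma neg_dart_inj e b c x :
  mends H e b = Some x -> mends H e c = Some x -> b = c.
Proof.
case: hN => -[_ [/(_ e) l _] _ _ _] _.
by case: b c => -[] // h1 h2; case/eqP: l; rewrite h1 h2.
Qed.

Lemma other_endE e b x :
  mends H e b = Some x -> other_end e x = mends H e (~~ b).
Proof.
rewrite /other_end => h; case: eqP => h2; first by rewrite (neg_dart_inj h h2).
by case: b h => // h; case: h2.
Qed.

Lemma neg_simple (e f : mE H) x y : x != y -> incident e x -> incident e y ->
  incident f x -> incident f y -> e = f.
Proof.
move=> xy ex ey fx fy; have [b [h1 h2]] := incident_both xy ex ey.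
have [c [h3 h4]] := incident_both xy fx fy.
case: hN => -[_ [_ [h _]] _ _ _] _; apply/eqP; apply: contraT => /h/existsP[].
exists (if c then b else ~~ b).
by case: c h3 h4 => /= h3 h4; rewrite ?negbK h1 h2 h3 h4 !eqxx.
Qed.

Lemma neg_uw : u != w.
Proof.
by case: hN => -[_ _]; rewrite /= !inE negb_or => /and3P[/andP[]].
Qed.

Lemma neg_uv : u != v.
Proof.
by case: hN => -[_ _]; rewrite /= !inE negb_or => /and3P[/andP[]].
Qed.

Lemma neg_wv : w != v.
Proof. by case: hN => -[_ _]; rewrite /= !inE => /and3P[]. Qed.

Lemma edge_uw : exists2 e, incident e u & incident e w.
Proof.
case: hN => -[_ _ _ /adjP[e [b [h1 h2]]] _] _.
by exists e; apply: mends_incident; eassumption.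
Qed.

Lemma edge_wv : exists2 e, incident e w & incident e v.
Proof.
case: hN => -[_ _ _ _ /adjP[e [b [h1 h2]]]] _.
by exists e; apply: mends_incident; eassumption.
Qed.

(** Such an edge would close the path u, w, v to a triangle, against the girth. *)
Lemma incident_uv e : incident e u -> incident e v -> False.
Proof.
move=> eu ev; case: hN => -[_ [_ [_ [tri _]]] U uw wv] _.
by apply: (tri _ _ _ U); split=> //; apply: (@incident_adj _ e); rewrite // eq_sym neg_uv.
Qed.

(** Besides the two semiedges there is the path edge to [w], distinct from them since they avoid
    [w]; cubicity leaves no room for a fourth edge. The same count works at [v] and at [w]. *)
Lemma at_u e : incident e u -> [\/ e = ni1 N, e = ni2 N | incident e w].
Proof.
have [f fu fw] := edge_uw; case: (hN) => _ [[i12 i1u i2u i1w i2w] _].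
have U : uniq [:: ni1 N; ni2 N; f].
  rewrite /= !inE negb_or i12 /= andbT.
  by apply/andP; split; [apply: contraNneq i1w|apply: contraNneq i2w] => ->.
move=> /(cubic_incident neg_cubic U i1u i2u fu).
by rewrite !inE => /or3P[]/eqP->; [apply: Or31|apply: Or32|apply: Or33].
Qed.

Lemma at_v e : incident e v -> [\/ e = no1 N, e = no2 N | incident e w].
Proof.
have [f fw fv] := edge_wv; case: (hN) => _ [_ [[o12 o1v o2v o1w o2w] _]].
have U : uniq [:: no1 N; no2 N; f].
  rewrite /= !inE negb_or o12 /= andbT.
  by apply/andP; split; [apply: contraNneq o1w|apply: contraNneq o2w] => ->.
move=> /(cubic_incident neg_cubic U o1v o2v fv).
by rewrite !inE => /or3P[]/eqP->; [apply: Or31|apply: Or32|apply: Or33].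
Qed.

Lemma at_w e : incident e w -> [\/ e = nr N, incident e u | incident e v].
Proof.
have [f fu fw] := edge_uw; have [g gw gv] := edge_wv.
case: (hN) => _ [_ [_ [rw ru rv]]].
have U : uniq [:: nr N; f; g].
  rewrite /= !inE negb_or andbT; apply/andP; split; [apply/andP; split|].
  - by apply: contraNneq ru => ->.
  - by apply: contraNneq rv => ->.
  - by apply/eqP=> E; apply: (@incident_uv f) => //; rewrite E.
move=> /(cubic_incident neg_cubic U rw fw gw).
by rewrite !inE => /or3P[]/eqP->; [apply: Or31|apply: Or32|apply: Or33].
Qed.

Lemma in_nD x : (x \in nD N) = [|| x == u, x == w | x == v].
Proof. by rewrite !inE orbA. Qed.

Lemma ni_u e : e \in [:: ni1 N; ni2 N] -> incident e u.
Proof. by case: hN => _ [[_ ? ? _ _] _]; rewrite !inE => /orP[]/eqP->. Qed.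

Lemma ni_w e : e \in [:: ni1 N; ni2 N] -> ~~ incident e w.
Proof. by case: hN => _ [[_ _ _ ? ?] _]; rewrite !inE => /orP[]/eqP->. Qed.

Lemma no_v e : e \in [:: no1 N; no2 N] -> incident e v.
Proof. by case: hN => _ [_ [[_ ? ? _ _] _]]; rewrite !inE => /orP[]/eqP->. Qed.

Lemma no_w e : e \in [:: no1 N; no2 N] -> ~~ incident e w.
Proof. by case: hN => _ [_ [[_ _ _ ? ?] _]]; rewrite !inE => /orP[]/eqP->. Qed.

Lemma nr_w : incident (nr N) w.
Proof. by case: hN => _ [_ [_ []]]. Qed.

Lemma ni_neq : ni1 N != ni2 N.
Proof. by case: hN => _ [[]]. Qed.

Lemma no_neq : no1 N != no2 N.
Proof. by case: hN => _ [_ [[]]]. Qed.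

Lemma no_ni e : e \in [:: no1 N; no2 N] -> e \notin [:: ni1 N; ni2 N].
Proof. by move=> /no_v ev; apply/negP=> /ni_u /incident_uv; apply. Qed.

Lemma nr_ni : nr N \notin [:: ni1 N; ni2 N].
Proof. by apply/negP=> /ni_w; rewrite nr_w. Qed.

Lemma nr_no : nr N \notin [:: no1 N; no2 N].
Proof. by apply/negP=> /no_w; rewrite nr_w. Qed.

(** The other end cannot be [u] (no loops), [w] (by the choice of the semiedges) or [v] (no
    triangle). *)
Lemma ni_end e b : e \in [:: ni1 N; ni2 N] -> mends H e b = Some u ->
  exists2 x, mends H e (~~ b) = Some x & x \notin nD N.
Proof.
move=> ei eb; have [x ex] := neg_end e (~~ b); exists x => //.
rewrite in_nD; apply/negP=> /or3P[]/eqP E; subst x.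
- by have := neg_dart_inj eb ex; case: (b).
- by move: (ni_w ei); rewrite (mends_incident ex).
- by case: (incident_uv (ni_u ei) (mends_incident ex)).
Qed.

Lemma no_end e b : e \in [:: no1 N; no2 N] -> mends H e b = Some v ->
  exists2 x, mends H e (~~ b) = Some x & x \notin nD N.
Proof.
move=> eo eb; have [x ex] := neg_end e (~~ b); exists x => //.
rewrite in_nD; apply/negP=> /or3P[]/eqP E; subst x.
- by case: (incident_uv (mends_incident ex) (no_v eo)).
- by move: (no_w eo); rewrite (mends_incident ex).
- by have := neg_dart_inj eb ex; case: (b).
Qed.

Lemma nr_end b : mends H (nr N) b = Some w ->
  exists2 x, mends H (nr N) (~~ b) = Some x & x \notin nD N.
Proof.
move=> eb; have [x ex] := neg_end (nr N) (~~ b); exists x => //.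
case: (hN) => _ [_ [_ [rw ru rv]]].
rewrite in_nD; apply/negP=> /or3P[]/eqP E; subst x.
- by move: ru; rewrite (mends_incident ex).
- by have := neg_dart_inj eb ex; case: (b).
- by move: rv; rewrite (mends_incident ex).
Qed.

(** * Edges of a negator that survive in the junction, and how they meet u, v, w *)

Lemma keepE_end e b x : e \notin [:: ni1 N; ni2 N] -> mends H e b = Some x ->
  x \notin nD N -> keepE N e.
Proof.
rewrite in_cons mem_seq1 negb_or => /andP[e1 e2] eb xD.
apply/and3P; split=> //.
by apply/existsP; exists b; rewrite eb.
Qed.

Lemma keepE_no e : e \in [:: no1 N; no2 N] -> keepE N e.
Proof.
move=> eo; have /incidentP[b /(no_end eo)[x ex xD]] := no_v eo.
exact: (keepE_end (no_ni eo) ex xD).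
Qed.

Lemma keepE_nr : keepE N (nr N).
Proof.
have /incidentP[b /nr_end[x ex xD]] := nr_w.
exact: (keepE_end nr_ni ex xD).
Qed.

Lemma keepE_far e : keepE N e -> exists2 x, incident e x & x \notin nD N.
Proof.
case/and3P=> /existsP[b]; have [x ex] := neg_end e b; rewrite ex /= => xD _ _.
by exists x => //; apply: mends_incident ex.
Qed.

Lemma keepE_ni e : keepE N e -> e \notin [:: ni1 N; ni2 N].
Proof. by case/and3P=> _ e1 e2; rewrite !inE negb_or e1. Qed.

(** A kept edge has an end outside [nD N], which leaves room for only one end inside. *)
Lemma keepE_two e x y : keepE N e -> x \in nD N -> y \in nD N -> x != y ->
  incident e x -> incident e y -> False.
Proof.
move=> /keepE_far[z ez zD] xD yD xy ex ey.
by case/orP: (incident_ends xy ex ey ez) zD => /eqP->; rewrite ?xD ?yD.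
Qed.

Lemma u_nD : u \in nD N. Proof. by rewrite in_nD eqxx. Qed.
Lemma w_nD : w \in nD N. Proof. by rewrite in_nD eqxx orbT. Qed.
Lemma v_nD : v \in nD N. Proof. by rewrite in_nD eqxx !orbT. Qed.

Lemma keepE_u e : keepE N e -> ~~ incident e u.
Proof.
move=> ke; apply/negP=> eu; have := keepE_ni ke; rewrite !inE.
case: (at_u eu) => [->|->|ew]; rewrite ?eqxx ?orbT // => _.
exact: (keepE_two ke u_nD w_nD neg_uw eu ew).
Qed.

Lemma keepE_v e : keepE N e -> incident e v -> e \in [:: no1 N; no2 N].
Proof.
move=> ke ev; rewrite !inE; case: (at_v ev) => [->|->|ew]; rewrite ?eqxx ?orbT //.
by case: (keepE_two ke w_nD v_nD neg_wv ew ev).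
Qed.

Lemma keepE_w e : keepE N e -> incident e w -> e = nr N.
Proof.
move=> ke ew; case: (at_w ew) => // [eu|ev].
  by case: (keepE_two ke u_nD w_nD neg_uw eu ew).
by case: (keepE_two ke w_nD v_nD neg_wv ew ev).
Qed.

End Negator.

(** * Signatures on the five semiedges *)

Definition signature : Type := (col * col * col * col * col)%type.

(** [T] collects the vertices deleted in addition to the path u, w, v; with [T] empty these are the
    signatures of the negator itself. *)
Definition realises (N : negdata) (T : {set mV (nH N)}) (t : signature) :=
  exists2 phi, colouring_off (nD N :|: T) phi & sig5 N phi = t.

(** A Boolean weakening of [perfect_set], without the conditions that colours be nonzero, so that
    concrete signatures can be refuted by computation. *)
Definition perfectb (t : signature) : bool :=
  let: (i1, i2, o1, o2, r) := t in
  [&& i1 == i2, o1 != o2 & r == o1 + o2]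
  || [&& o1 == o2, i1 != i2 & r == i1 + i2].

Lemma perfect_setW t : perfect_set t -> perfectb t.
Proof.
by case=> z [a [b [_ _ _ ab [->|->]]]]; rewrite /= !eqxx ab ?orbT.
Qed.

Lemma perfect_realises N t : perfect N -> perfect_set t -> realises (N := N) set0 t.
Proof.
move=> pN /pN[phi [/colouring_delete h1 h2]]; exists phi => //.
by rewrite setU0.
Qed.

Lemma perfect_sig5 N phi :
  perfect N -> colouring_off (nD N) phi -> perfect_set (sig5 N phi).
Proof. by move=> pN /colouring_delete h; apply/pN; exists phi. Qed.

(** Agreement of colours where O of the first negator is joined to I of the second; as in [partner],
    a true [s] means the crossed bijection. *)
Definition junction (s : bool) (t t' : signature) : Prop :=
  let: (_, _, o1, o2, _) := t in let: (i1, i2, _, _, _) := t' in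
  (o1, o2) = if s then (i2, i1) else (i1, i2).

(** Whether a pair is equal or unequal is flipped by each perfect signature and preserved by each
    junction; three flips cannot return to the start. *)
Lemma perfect_cycle s1 s2 s3 t1 t2 t3 :
  perfect_set t1 -> perfect_set t2 -> perfect_set t3 ->
  junction s1 t1 t2 -> junction s2 t2 t3 -> junction s3 t3 t1 -> False.
Proof.
have neg t : perfect_set t ->
    (t.1.1.1.1 == t.1.1.1.2) = (t.1.1.2 != t.1.2).
  case=> z [a [b [_ _ _ ab [->|->]]]] /=; first by rewrite eqxx ab.
  by rewrite eqxx (negPf ab).
have jn s t t' : junction s t t' ->
    (t.1.1.2 == t.1.2) = (t'.1.1.1.1 == t'.1.1.1.2).
  case: t t' => [[[[? ?] ?] ?] ?] [[[[? ?] ?] ?] ?] /=.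
  by case: s => -[-> ->] //; rewrite eq_sym.
move=> /neg n1 /neg n2 /neg n3 /jn j1 /jn j2 /jn j3.
by move: n1 n2 n3; rewrite j1 j2 j3; do 3!case: eqP.
Qed.

Lemma junction_eq s i1 i2 c r d o1 o2 r' :
  c = d -> junction s (i1, i2, c, c, r) (d, d, o1, o2, r').
Proof. by move=> ->; case: s. Qed.

(** * Signatures that a feasible negator realises after vertex deletions *)

Section Realise.
Variables (N : negdata) (hN : is_negator N) (fN : feasible N).
Local Notation H := (nH N).

Lemma val_nD (x : NV N) : val x \notin nD N.
Proof. exact: (valP x). Qed.

Lemma notin_nD2 (z : mV H) (x y : NV N) :
  z \in nD N -> z \notin [set val x; val y].
Proof.
move=> zD; rewrite !inE negb_or.
by apply/andP; split; apply: contraTneq zD => ->; apply: val_nD.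
Qed.

(** Properness at [u] gives the edge [uw] the colour that is the sum of the two on I; at [w] this
    edge meets [nr N]. *)
Lemma colouring_off_u (A : {set mV H}) phi : colouring_off A phi ->
  nu N \notin A -> nw N \notin A ->
  phi (ni1 N) != phi (ni2 N) /\ phi (nr N) != phi (ni1 N) + phi (ni2 N).
Proof.
move=> h uA wA; have [f fu fw] := edge_uw hN.
have fni e : e \in [:: ni1 N; ni2 N] -> e != f.
  by move=> /(ni_w hN); apply: contraNneq => ->.
have rf : nr N != f.
  by apply: contraTneq (keepE_nr hN) => ->; apply/negP=> /(keepE_u hN); rewrite fu.
have i1 : ni1 N \in [:: ni1 N; ni2 N] by rewrite inE eqxx.
have i2 : ni2 N \in [:: ni1 N; ni2 N] by rewrite !inE eqxx orbT.
have i12 := colouring_off_neq h uA (ni_u hN i1) (ni_u hN i2) (ni_neq hN).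
split=> //; rewrite (inK_third (c := phi f)) ?(h.1) //.
- exact: (colouring_off_neq h wA (nr_w hN) fw).
- exact: (colouring_off_neq h uA (ni_u hN i1) fu (fni _ i1)).
- exact: (colouring_off_neq h uA (ni_u hN i2) fu (fni _ i2)).
Qed.

Lemma colouring_off_v (A : {set mV H}) phi : colouring_off A phi ->
  nv N \notin A -> nw N \notin A ->
  phi (no1 N) != phi (no2 N) /\ phi (nr N) != phi (no1 N) + phi (no2 N).
Proof.
move=> h vA wA; have [f fw fv] := edge_wv hN.
have fno e : e \in [:: no1 N; no2 N] -> e != f.
  by move=> /(no_w hN); apply: contraNneq => ->.
have rf : nr N != f.
  apply: contraTneq (nr_no hN) => E; rewrite E negbK (keepE_v hN) //.
  by rewrite -E (keepE_nr hN).
have i1 : no1 N \in [:: no1 N; no2 N] by rewrite inE eqxx.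
have i2 : no2 N \in [:: no1 N; no2 N] by rewrite !inE eqxx orbT.
have i12 := colouring_off_neq h vA (no_v hN i1) (no_v hN i2) (no_neq hN).
split=> //; rewrite (inK_third (c := phi f)) ?(h.1) //.
- exact: (colouring_off_neq h wA (nr_w hN) fw).
- exact: (colouring_off_neq h vA (no_v hN i1) fv (fno _ i1)).
- exact: (colouring_off_neq h vA (no_v hN i2) fv (fno _ i2)).
Qed.

(** The two sums are the colours of the path edges [uw] and [wv], which meet at [w]. *)
Lemma uw_vw_neq (A : {set mV H}) phi : colouring_off A phi ->
  nu N \notin A -> nw N \notin A -> nv N \notin A ->
  phi (ni1 N) + phi (ni2 N) != phi (no1 N) + phi (no2 N).
Proof.
move=> h uA wA vA; have [f fu fw] := edge_uw hN; have [g gw gv] := edge_wv hN.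
have i1 : ni1 N \in [:: ni1 N; ni2 N] by rewrite inE eqxx.
have i2 : ni2 N \in [:: ni1 N; ni2 N] by rewrite !inE eqxx orbT.
have o1 : no1 N \in [:: no1 N; no2 N] by rewrite inE eqxx.
have o2 : no2 N \in [:: no1 N; no2 N] by rewrite !inE eqxx orbT.
have fni e : e \in [:: ni1 N; ni2 N] -> e != f.
  by move=> /(ni_w hN); apply: contraNneq => ->.
have fno e : e \in [:: no1 N; no2 N] -> e != g.
  by move=> /(no_w hN); apply: contraNneq => ->.
have fg : f != g by apply/eqP=> E; case: (incident_uv hN fu); rewrite E.
rewrite (inK_third (c := phi f)) ?(h.1) //.
- rewrite (inK_third (c := phi g)) ?(h.1) //.
  + exact: (colouring_off_neq h wA fw gw).
  + exact: (colouring_off_neq h vA (no_v hN o1) (no_v hN o2) (no_neq hN)).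
  + exact: (colouring_off_neq h vA (no_v hN o1) gv (fno _ o1)).
  + exact: (colouring_off_neq h vA (no_v hN o2) gv (fno _ o2)).
- exact: (colouring_off_neq h uA (ni_u hN i1) (ni_u hN i2) (ni_neq hN)).
- exact: (colouring_off_neq h uA (ni_u hN i1) fu (fni _ i1)).
- exact: (colouring_off_neq h uA (ni_u hN i2) fu (fni _ i2)).
Qed.

(** Condition (0) colours [H] without [x] and [y], where u, w, v survive. Properness at [u] and [v]
    makes both pairs unequal, and the three values in [uniq] are the colours of the edges at [w]. *)
Lemma realises_two (x y : NV N) : x != y ->
  exists p q p' q' r, [/\ [/\ inK p, inK q, inK p' & inK q'], p != q, p' != q',
    uniq [:: r; p' + q'; p + q] &
    realises [set val x; val y] (p, q, p', q', r)].
Proof.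
case: fN => h _ /h[phi /colouring_delete hphi].
have uA := notin_nD2 x y (u_nD N).
have wA := notin_nD2 x y (w_nD N).
have vA := notin_nD2 x y (v_nD N).
have [n1 n2] := colouring_off_u hphi uA wA.
have [n3 n4] := colouring_off_v hphi vA wA.
have n5 := uw_vw_neq hphi uA wA vA.
exists (phi (ni1 N)), (phi (ni2 N)), (phi (no1 N)), (phi (no2 N)), (phi (nr N)).
split=> //; first by split; apply: (hphi.1).
  by rewrite /= !inE negb_or n2 n4 eq_sym n5.
by exists phi => //; apply: colouring_off_sub hphi; apply: subsetUr.
Qed.

(** Condition (ii) gives such signatures for some two colours and both choices on [r]; a permutation
    of the colours carries them to the prescribed [c] and [d]. *)
Lemma realises_eqeq (y : NV N) (c d r : col) :
  inK c -> inK d -> c != d -> r \in [:: c; d] ->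
  realises [set val y] (c, c, d, d, r).
Proof.
move=> Kc Kd cd; case: fN => _ [_ /(_ y)[a [b [Ka Kb ab]]]].
move=> [phi [/colouring_delete1 hphi sphi]] [psi [/colouring_delete1 hpsi spsi]].
have [f [fi fK fa fb]] := col_perm2 Ka Kb Kc Kd ab cd.
rewrite !inE => /orP[]/eqP->.
  exists (f \o phi); first exact: colouring_off_comp.
  by case: sphi => h1 h2 h3 h4 h5; rewrite /sig5 /= h1 h2 h3 h4 h5 fa fb.
exists (f \o psi); first exact: colouring_off_comp.
by case: spsi => h1 h2 h3 h4 h5; rewrite /sig5 /= h1 h2 h3 h4 h5 fa fb.
Qed.

(* If an edge of O is incident with x, it is isolated in H - {v, x} and may be
   recoloured freely. *)
Lemma colouring_eq_no (x : NV N) :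
  exists2 phi, colouring_off [set nv N; val x] phi & phi (no1 N) = phi (no2 N).
Proof.
case: fN => _ [h2 _].
have vx : nv N \in [set nu N; nv N] by rewrite !inE eqxx orbT.
have o1 : no1 N \in [:: no1 N; no2 N] by rewrite inE eqxx.
have o2 : no2 N \in [:: no1 N; no2 N] by rewrite !inE eqxx orbT.
have [f fw fv] := edge_wv hN.
have fno e : e \in [:: no1 N; no2 N] -> e != f.
  by move=> /(no_w hN); apply: contraNneq => ->.
have fx : ~~ incident f (val x).
  apply/negP=> /(incident_ends (neg_wv hN) fw fv) E.
  by have := val_nD x; rewrite in_nD E orbT.
have vneq : nv N != val x.
  by apply: contraTneq (v_nD N) => ->; apply: val_nD.
have recol e e' : e \in [:: no1 N; no2 N] -> e' \in [:: no1 N; no2 N] ->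
    e != e' -> incident e (val x) ->
    exists2 phi, colouring_off [set nv N; val x] phi & phi e = phi e'.
  move=> eo eo' ee' ex.
  have ex' : ~~ incident e' (val x).
    apply/negP=> ex'; case/eqP: ee'.
    exact: (neg_simple hN vneq (no_v hN eo) ex (no_v hN eo') ex').
  (* The edges [f] and [e'] at [v] both miss [x], the latter because parallel edges are excluded, so
     condition (i) applies to them. The colouring obtained is changed only on [e], which takes the
     colour of [e']. *)
  have [phi [/colouring_delete [K P] _]] :=
    h2 _ x vx _ _ (fno _ eo') (no_v hN eo') ex' fv fx.
  exists (fun g => if g == e then phi e' else phi g); last first.
    by rewrite eqxx eq_sym (negPf ee').
  split=> [g|z zA]; first by case: ifP.
  have off g b : (g, b) \in darts z -> g == e = false.
    rewrite in_darts => /eqP/mends_incident gz; apply: contraNF zA => /eqP E.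
    by rewrite !inE (incident_ends vneq (no_v hN eo) ex) // -E.
  move=> [g b] [g' b'] gz gz'; rewrite /= (off _ _ gz) (off _ _ gz').
  exact: (P z zA (g, b) (g', b')).
case e1 : (incident (no1 N) (val x)).
  by apply: recol => //; apply: no_neq.
case e2 : (incident (no2 N) (val x)).
  have [||||phi h E] := recol (no2 N) (no1 N) => //.
    by rewrite eq_sym no_neq.
  by exists phi.
have [phi [/colouring_delete hphi E]] :=
  h2 _ x vx _ _ (no_neq hN) (no_v hN o1) (negbT e1) (no_v hN o2) (negbT e2).
by exists phi.
Qed.

(** Deleting [v] allows an equal O-pair, while [u] and [w] survive: the I-pair is unequal, and the
    colour on [r] avoids its sum, so it is one of the two I-colours. *)
Lemma realises_neq_eq (x : NV N) :
  exists a b c r, [/\ [/\ inK a, inK b & inK c], a != b, r \in [:: a; b] &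
    realises [set val x] (a, b, c, c, r)].
Proof.
have [phi hphi E] := colouring_eq_no x.
have uA : nu N \notin [set nv N; val x].
  rewrite !inE negb_or neg_uv //=.
  by apply: contraTneq (u_nD N) => ->; apply: val_nD.
have wA : nw N \notin [set nv N; val x].
  rewrite !inE negb_or neg_wv //=.
  by apply: contraTneq (w_nD N) => ->; apply: val_nD.
have [n1 n2] := colouring_off_u hphi uA wA.
exists (phi (ni1 N)), (phi (ni2 N)), (phi (no1 N)), (phi (nr N)); split=> //.
- by split; apply: (hphi.1).
- move: n1 n2; have [/(_ (ni1 N)) + _] := hphi; have [/(_ (ni2 N)) + _] := hphi.
  have [/(_ (nr N)) + _] := hphi.
  by move=> /inKP[]-> /inKP[]-> /inKP[]->.
- exists phi; last by rewrite /sig5 -E.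
  apply: colouring_off_sub hphi; apply: setSU.
  by apply/subsetP=> z; rewrite in_nD inE => ->; rewrite !orbT.
Qed.

End Realise.

(** * Compatible signatures around the cycle of three negators *)

Section Cases.
Variables (N1 N2 N3 : negdata) (s1 s2 s3 : bool).

(** What a colouring of the junction with deleted vertices amounts to on semiedges. The [uniq]
    condition is properness at the new vertex, waived when that vertex is deleted. *)
Definition cyclic_colouring (T1 : {set mV (nH N1)}) (T2 : {set mV (nH N2)})
    (T3 : {set mV (nH N3)}) (centre_deleted : bool) : Prop :=
  exists t1 t2 t3,
    [/\ realises T1 t1, realises T2 t2 & realises T3 t3] /\
    [/\ junction s1 t1 t2, junction s2 t2 t3 & junction s3 t3 t1] /\
    (centre_deleted || uniq [:: t1.2; t2.2; t3.2]).

Hypotheses (h1 : is_negator N1) (h2 : is_negator N2).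
Hypotheses (f1 : feasible N1) (f2 : feasible N2).
Hypotheses (p2 : perfect N2) (p3 : perfect N3).

Lemma cyclic_colouring_centre (y : NV N1) :
  cyclic_colouring [set val y] set0 set0 true.
Proof.
(* [N1] has equal pairs on both sides by condition (ii); [N2] turns the pair 10, 10 into an unequal
   one, and [N3] turns that into 01, 01, which closes the cycle at [N1]. Only the junction carrying
   the unequal pair depends on its bit [s2]. *)
exists (c01, c01, c10, c10, c01), (c10, c10, c01, c10, c11).
exists (if s2 then (c10, c01, c01, c01, c11) else (c01, c10, c01, c01, c11)).
split; [split|split=> //; split].
- exact: realises_eqeq.
- apply: perfect_realises => //; exists c10, c01, c10.
  by split=> //; left; congr (_, _); apply/eqP.
- apply: perfect_realises => //; case: (s2).
    by exists c01, c10, c01; split=> //; right; congr (_, _); apply/eqP.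
  by exists c01, c01, c10; split=> //; right; congr (_, _); apply/eqP.
- exact: junction_eq.
- by case: (s2).
- by case: (s2); apply: junction_eq.
Qed.

Lemma cyclic_colouring_same (x y : NV N1) : x != y ->
  cyclic_colouring [set val x; val y] set0 set0 false.
Proof.
move=> /(realises_two h1 f1)[p [q [p' [q' [r]]]]].
case=> -[Kp Kq Kp' Kq'] pq pq' U real1.
(* [N2] turns the unequal O-pair of [N1] into an equal pair, arbitrarily coloured 01, and [N3] turns
   this into the unequal I-pair of [N1]. The colours at the centre are those of the edges at [w] in
   the first negator. *)
exists (p, q, p', q', r).
exists (if s1 then (q', p', c01, c01, p' + q') else (p', q', c01, c01, p' + q')).
exists (if s3 then (c01, c01, q, p, p + q) else (c01, c01, p, q, p + q)).
split; [split=> //|split; [split|by case: (s1); case: (s3)]].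
- apply: perfect_realises => //; case: (s1).
    by exists c01, q', p'; rewrite eq_sym addrC; split=> //; right.
  by exists c01, p', q'; split=> //; right.
- apply: perfect_realises => //; case: (s3).
    by exists c01, q, p; rewrite eq_sym addrC; split=> //; left.
  by exists c01, p, q; split=> //; left.
- by case: (s1).
- by case: (s1); case: (s3); apply: junction_eq.
- by case: (s3).
Qed.

Lemma cyclic_colouring_next (x : NV N1) (y : NV N2) :
  cyclic_colouring [set val x] [set val y] set0 false.
Proof.
have [a [b [c [r [[Ka Kb Kc] ab rab real1]]]]] := realises_neq_eq h1 f1 x.
(* Since [r] is [a] or [b], [t] is the other one, and [r], [t], [a + b] are the three colours wanted
   at the centre. *)
pose t := r + (a + b).
have Kt : inK t /\ uniq [:: r; t; a + b].
  rewrite /t; move: rab; rewrite !inE => /orP[]/eqP->; move: ab.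
    by case/inKP: Ka => ->; case/inKP: Kb => ->.
  by case/inKP: Ka => ->; case/inKP: Kb => ->.
(* Condition (ii) for [N2] allows on its [r] only a colour of one of its two pairs. The I-pair has
   colour [c], so the O-pair takes [t], or any other colour if [t] is [c] already. *)
have [d [Kd cd td]] : exists d, [/\ inK d, c != d & t \in [:: c; d]].
  have [<-|tc] := eqVneq t c.
    by have [d Kd cd] := inK_avoid Kt.1; exists d; rewrite inE eqxx.
  by exists t; rewrite !inE eqxx orbT eq_sym Kt.1.
exists (a, b, c, c, r), (c, c, d, d, t).
exists (if s3 then (d, d, b, a, a + b) else (d, d, a, b, a + b)).
split; [split=> //|split; [split|by case: (s3); case: Kt]].
- exact: realises_eqeq.
- apply: perfect_realises => //; case: (s3).
    by exists d, b, a; rewrite eq_sym addrC; split=> //; left.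
  by exists d, a, b; split=> //; left.
- exact: junction_eq.
- by case: (s3); apply: junction_eq.
- by case: (s3).
Qed.

End Cases.

(** The construction is cyclically symmetric, so the cases above, which start at the first negator,
    serve for all three. *)
Lemma cyclic_colouring_rot N1 N2 N3 s1 s2 s3 T1 T2 T3 b :
  @cyclic_colouring N2 N3 N1 s2 s3 s1 T2 T3 T1 b ->
  @cyclic_colouring N1 N2 N3 s1 s2 s3 T1 T2 T3 b.
Proof.
case=> t2 [t3 [t1 [[r2 r3 r1] [[j2 j3 j1] u]]]]; exists t1, t2, t3.
split; [by []|split=> //]; case/orP: u => [->//|u]; apply/orP; right.
by rewrite -(rot_uniq 1).
Qed.

(** * Connection of every vertex of a perfect negator to the semiedge r *)

(** The linear automorphism that permutes the colours cyclically, 01 to 10 to 11 to 01; it fixes no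
    colour. *)
Definition rot_col (c : col) : col := (c.1 + c.2, c.1).

Lemma rot_col_inj : injective rot_col.
Proof.
move=> [a b] [c d] E; have := congr1 fst E; have := congr1 snd E => /= -> h.
by rewrite (addrI c h).
Qed.

Lemma rot_col_inK c : inK c -> inK (rot_col c).
Proof. by move=> /inKP[]->. Qed.

Section Connect.
Variables (N : negdata) (hN : is_negator N) (pN : perfect N).
Local Notation H := (nH N).

Definition adj_off (x y : mV H) := [&& adj H x y, x \notin nD N & y \notin nD N].

(* Otherwise the component of z meets a nonempty set of semiedges avoiding r,
   and rotating the colours on that component alone produces a colouring whose
   signature is not in the perfect set. *)
Lemma connect_to_nr (z : mV H) : z \notin nD N ->
  exists x, [/\ x \notin nD N, incident (nr N) x & connect adj_off z x].
Proof.
move=> zD; pose C := [set x | connect adj_off z x].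
have CD x : x \in C -> x \notin nD N.
  rewrite inE => /connectP[p]; case/lastP: p => [_ ->//|p y].
  by rewrite rcons_path last_rcons => /andP[_ /and3P[]] _ _ yD ->.
have Cstep x y : x \in C -> adj H x y -> y \notin nD N -> y \in C.
  move=> xC xy yD; have xD := CD _ xC; move: xC; rewrite !inE => zx.
  by apply: connect_trans zx (connect1 _); apply/and3P.
pose touch e := [exists x, (x \in C) && incident e x].
have touchI e x : x \in C -> incident e x -> touch e.
  by move=> xC ex; apply/existsP; exists x; rewrite xC.
have touch_off e x : x \notin nD N -> x \notin C -> incident e x -> ~~ touch e.
  move=> xD xC ex; apply/existsP=> -[y /andP[yC ey]].
  case/negP: (xC); apply: (Cstep y) => //; apply: (incident_adj _ ey ex).
  by apply: contraNneq xC => <-.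
have [tr|tr] := boolP (touch (nr N)).
  case/existsP: tr => x /andP[xC rx]; exists x; split=> //; first exact: CD.
  by move: xC; rewrite inE.
exfalso.
(* At a vertex outside [nD N] either all edges are touched or none, according to membership in [C],
   so the recoloured map is still proper there. *)
have recol phi : colouring_off (nD N) phi -> perfectb
    (sig5 N (fun e => if touch e then rot_col (phi e) else phi e)).
  move=> [K P]; apply: perfect_setW; apply: perfect_sig5 => //; split.
    by move=> e; case: ifP => // _; apply: rot_col_inK.
  move=> x xD [e b] [f c] ex fx /=.
  have ei : incident e x by move: ex; rewrite in_darts => /eqP/mends_incident.
  have fi : incident f x by move: fx; rewrite in_darts => /eqP/mends_incident.
  have [xC|xC] := boolP (x \in C).
    rewrite (touchI _ _ xC ei) (touchI _ _ xC fi) => /rot_col_inj.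
    exact: (P x xD (e, b) (f, c)).
  rewrite (negPf (touch_off _ _ xD xC ei)) (negPf (touch_off _ _ xD xC fi)).
  exact: (P x xD (e, b) (f, c)).
have get t : perfect_set t -> exists2 phi, colouring_off (nD N) phi & sig5 N phi = t.
  by case/pN => phi [/colouring_delete]; exists phi.
(* An edge from [C] to one of u, w, v is a semiedge, since a path edge has both ends in [nD N]. With
   all five semiedges untouched, no edge leaves [C]. *)
have closedC x y : ~~ [|| touch (ni1 N), touch (ni2 N), touch (no1 N) | touch (no2 N)] ->
    x \in C -> adj H x y -> y \in C.
  rewrite !negb_or => /and4P[t1 t2 t3 t4] xC xy.
  have xD := CD _ xC; apply: Cstep (xy) _ => //; apply/negP.
  have /adjP[e [b [/mends_incident ex /mends_incident ey]]] := xy.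
  have te := touchI _ _ xC ex.
  have two p q : p \in nD N -> q \in nD N -> p != q ->
      incident e p -> incident e q -> False.
    move=> pD qD pq ep eq; case/orP: (incident_ends pq ep eq ex) xD => /eqP->.
      by rewrite pD.
    by rewrite qD.
  rewrite in_nD => /or3P[]/eqP E; subst y.
  - case: (at_u hN ey) => [E|E|ew]; try by move: te; rewrite E ?(negPf t1) ?(negPf t2).
    exact: (two _ _ (u_nD N) (w_nD N) (neg_uw hN)).
  - case: (at_w hN ey) => [E|eu|ev]; first by move: te; rewrite E (negPf tr).
      exact: (two _ _ (u_nD N) (w_nD N) (neg_uw hN)).
    exact: (two _ _ (w_nD N) (v_nD N) (neg_wv hN)).
  - case: (at_v hN ey) => [E|E|ew]; try by move: te; rewrite E ?(negPf t3) ?(negPf t4).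
    exact: (two _ _ (w_nD N) (v_nD N) (neg_wv hN)).
have [phi cphi sphi] : exists2 phi, colouring_off (nD N) phi &
    sig5 N phi = (c10, c10, c01, c10, c11).
  by apply: get; exists c10, c01, c10; split=> //; left; congr (_, _); apply/eqP.
have [psi cpsi spsi] : exists2 psi, colouring_off (nD N) psi &
    sig5 N psi = (c01, c10, c10, c10, c11).
  by apply: get; exists c10, c01, c10; split=> //; right; congr (_, _); apply/eqP.
(* For [phi] the rotated signature stays perfect only if none or exactly both of I are touched, for
   [psi] only if none or exactly both of O are. Hence no semiedge is touched, [C] is closed under
   adjacency, and connectedness of [H] puts [u] in [C]. *)
move: (recol _ cphi) (recol _ cpsi) closedC.
case: sphi spsi => a1 a2 a3 a4 a5 [b1 b2 b3 b4 b5].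
rewrite /sig5 /perfectb a1 a2 a3 a4 a5 b1 b2 b3 b4 b5 (negPf tr).
case: (touch (ni1 N)); case: (touch (ni2 N)); case: (touch (no1 N));
  case: (touch (no2 N)) => // _ _ clC.
have zC : z \in C by rewrite inE.
have /connectP[p pp E] := neg_connected hN z (nu N).
suff : nu N \in C by move/CD; rewrite u_nD.
rewrite {}E; move: zC pp; elim: p (z) => //= y p IH x xC /andP[xy].
by apply: IH; apply: clC xy.
Qed.

End Connect.

(** * A negator together with its predecessor inside a larger graph *)

(** An interface that treats the three negators uniformly. The I-edges of [N] have no copy in [G]:
    each is represented by the O-edge of the predecessor [P] merged with it, whose end at [v] moves
    to the far end of the I-edge, as [block_prev] records. *)
Record block (G : multipole) (P N : negdata) (s : bool)
    (jP : KE P -> mE G) (jN : KE N -> mE G) (k : NV N -> mV G) : Prop := Block {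
  block_injP : injective jP;
  block_injN : injective jN;
  block_disjoint : forall e f, jP e <> jN f;
  block_own : forall e b z, mends G (jN e) b = Some (k z) <->
    mends (nH N) (val e) b = Some (val z);
  block_prev : forall e b z, mends G (jP e) b = Some (k z) <->
    mends (nH P) (val e) b = Some (nv P) /\
    other_end (partner P N s (val e)) (nu N) = Some (val z);
  block_cover : forall g b z, mends G g b = Some (k z) ->
    (exists e, g = jN e) \/ (exists e, g = jP e) }.

Section Block.
Variables (G : multipole) (P N : negdata) (s : bool).
Variables (jP : KE P -> mE G) (jN : KE N -> mE G) (k : NV N -> mV G).
Hypotheses (hP : is_negator P) (hN : is_negator N) (B : block s jP jN k).

(** The inverse of [partner] between the semiedges I of [N] and O of [P]; the exclusive or with [s]
    undoes the crossing. *)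
Definition copartner (e : mE (nH N)) : mE (nH P) :=
  if (e == ni1 N) (+) s then no1 P else no2 P.

Lemma copartner_no e : copartner e \in [:: no1 P; no2 P].
Proof. by rewrite /copartner !inE; case: ifP; rewrite eqxx ?orbT. Qed.

Lemma copartnerK e : e \in [:: ni1 N; ni2 N] -> partner P N s (copartner e) = e.
Proof.
have n21 : (ni2 N == ni1 N) = false by rewrite eq_sym (negPf (ni_neq hN)).
have o21 : (no2 P == no1 P) = false by rewrite eq_sym (negPf (no_neq hP)).
rewrite /copartner /partner !inE => /orP[]/eqP->; rewrite ?eqxx ?n21;
  by case: (s); rewrite ?eqxx ?o21.
Qed.

Lemma partner_ni e : partner P N s e \in [:: ni1 N; ni2 N].
Proof. by rewrite /partner !inE; case: ifP; case: (s); rewrite eqxx ?orbT. Qed.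

Lemma partnerK e : e \in [:: no1 P; no2 P] -> copartner (partner P N s e) = e.
Proof.
have n21 : (ni2 N == ni1 N) = false by rewrite eq_sym (negPf (ni_neq hN)).
have o21 : (no2 P == no1 P) = false by rewrite eq_sym (negPf (no_neq hP)).
rewrite /copartner /partner !inE => /orP[]/eqP->; rewrite ?eqxx ?o21;
  by case: (s); rewrite ?eqxx ?n21.
Qed.

(** The second branch is meant for I-edges. The path edges also fall there and get a default value,
    but they have no dart at a vertex outside [nD N]. *)
Definition edge_img (e : mE (nH N)) : mE G :=
  if insub e is Some e' then jN e'
  else jP (Sub (copartner e) (keepE_no hP (copartner_no e))).

(** For an I-edge the end to take on the merged edge is the one formerly at [v] in [P], since that
    is the end redirected into [N]. *)
Definition dart_img (d : mE (nH N) * bool) : mE G * bool :=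
  (edge_img d.1, if keepE N d.1 then d.2
                 else mends (nH P) (copartner d.1) true == Some (nv P)).

Lemma edge_img_keep (e : KE N) : edge_img (val e) = jN e.
Proof. by rewrite /edge_img valK. Qed.

Lemma edge_img_Sub e (ke : keepE N e) : edge_img e = jN (Sub e ke).
Proof. by rewrite /edge_img insubT. Qed.

Lemma edge_img_ni e : e \in [:: ni1 N; ni2 N] ->
  edge_img e = jP (Sub (copartner e) (keepE_no hP (copartner_no e))).
Proof.
move=> ei; rewrite /edge_img insubF //.
by apply: contraTF ei; apply: keepE_ni.
Qed.

Lemma edge_img_partner (e : KE P) : val e \in [:: no1 P; no2 P] ->
  edge_img (partner P N s (val e)) = jP e.
Proof.
move=> eo; rewrite edge_img_ni ?partner_ni //; congr jP.
by apply: val_inj; rewrite /= partnerK.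
Qed.

Lemma dart_kept_or_ni (z : NV N) e b : (e, b) \in darts (val z) ->
  keepE N e \/ (e \in [:: ni1 N; ni2 N] /\ ~~ keepE N e).
Proof.
rewrite in_darts => /eqP ez.
have [ei|ei] := boolP (e \in [:: ni1 N; ni2 N]); [right|left].
  by split=> //; apply/negP=> /keepE_ni; rewrite ei.
exact: (keepE_end ei ez (val_nD z)).
Qed.

Lemma v_dart e b : e \in [:: no1 P; no2 P] ->
  mends (nH P) e b = Some (nv P) <->
  b = (mends (nH P) e true == Some (nv P)).
Proof.
move=> eo; split=> [h|].
  case: eqP => [h'|h']; first exact: (neg_dart_inj hP h h').
  by case: b h => // h; case: h'.
have /incidentP[c h] := no_v hP eo.
case: eqP => [h' ->//|h' ->].
by case: c h => // h; case: h'.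
Qed.

Lemma ni_other_end e b (z : NV N) : e \in [:: ni1 N; ni2 N] ->
  mends (nH N) e b = Some (val z) <->
  other_end e (nu N) = Some (val z) /\ mends (nH N) e (~~ b) = Some (nu N).
Proof.
move=> ei; split=> [h|[h1 h2]]; last by rewrite (other_endE hN h2) negbK in h1.
have uz : nu N != val z by apply: contraTneq (u_nD N) => ->; apply: val_nD.
have [c [h1 h2]] := incident_both uz (ni_u hN ei) (mends_incident h).
rewrite (neg_dart_inj hN h h2) negbK; split=> //.
by rewrite (other_endE hN h1).
Qed.

Lemma dart_img_in (z : NV N) d : d \in darts (val z) -> dart_img d \in darts (k z).
Proof.
case: d => e b dz; rewrite /dart_img in_darts /=; apply/eqP.
have := dz; rewrite in_darts => /eqP ez.
case: (dart_kept_or_ni dz) => [ke|[ei /negPf ke]]; rewrite ke.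
  by rewrite (edge_img_Sub ke); apply/(block_own B).
rewrite edge_img_ni //; apply/(block_prev B); split.
  by apply/v_dart => //; apply: copartner_no.
by rewrite SubK copartnerK //; have [] := (ni_other_end b z ei).1 ez.
Qed.

Lemma dart_img_inj (z : NV N) : {in darts (val z) &, injective dart_img}.
Proof.
move=> [e b] [f c] ez fz; rewrite /dart_img /= => -[].
have ez' : mends (nH N) e b = Some (val z) by apply/eqP; rewrite -in_darts.
have fz' : mends (nH N) f c = Some (val z) by apply/eqP; rewrite -in_darts.
case: (dart_kept_or_ni ez) => [ke|[ei ke]];
case: (dart_kept_or_ni fz) => [kf|[fi kf]].
- rewrite ke kf (edge_img_Sub ke) (edge_img_Sub kf).
  by move=> /(block_injN B)/(congr1 val); rewrite !SubK => -> ->.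
- rewrite (edge_img_Sub ke) (edge_img_ni fi).
  by move=> /esym/(block_disjoint B).
- rewrite (edge_img_Sub kf) (edge_img_ni ei).
  by move=> /(block_disjoint B).
- rewrite (edge_img_ni ei) (edge_img_ni fi) => /(block_injP B)/(congr1 val).
  rewrite !SubK => /(congr1 (partner P N s)); rewrite !copartnerK // => E _.
  by subst f; rewrite (neg_dart_inj hN ez' fz').
Qed.

(** With [dart_img_inj] this is a bijection of darts, through which cubicity and properness pass
    between [H] and [G]. *)
Lemma dart_img_darts (z : NV N) : darts (k z) = dart_img @: darts (val z).
Proof.
apply/eqP; rewrite eqEsubset; apply/andP; split; apply/subsetP; last first.
  by move=> _ /imsetP[d dz ->]; apply: dart_img_in.
move=> [g b]; rewrite in_darts => /eqP gz; apply/imsetP.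
case: (block_cover B gz) => -[e E]; subst g.
  exists (val e, b); first by rewrite in_darts; apply/eqP/(block_own B).
  by rewrite /dart_img /= edge_img_keep (valP e).
have [ev ez] := (block_prev B _ _ _).1 gz.
have eo := keepE_v hP (valP e) (mends_incident ev).
have pi := partner_ni (val e).
have /incidentP[c uc] := ni_u hN pi.
exists (partner P N s (val e), ~~ c).
  by rewrite in_darts; apply/eqP/(ni_other_end _ _ pi); rewrite negbK.
rewrite /dart_img /= edge_img_partner // partnerK //.
rewrite (negPf (contraL (@keepE_ni _ _) pi)).
by have := (v_dart b eo).1 ev => <-.
Qed.

Lemma block_cubic (z : NV N) : #|darts (k z)| = 3.
Proof.
by rewrite dart_img_darts (card_in_imset (@dart_img_inj z)); apply: neg_cubic.
Qed.

(** Distinct darts at a vertex of [N] have distinct images at its copy in [G], so a colouring pulls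
    back along [edge_img]. *)
Lemma block_restrict psi :
  colouring_off (set0 : {set mV G}) psi -> colouring_off (nD N) (psi \o edge_img).
Proof.
move=> [K C]; split=> [e|x xD d d' dx dx' E]; first exact: K.
pose z : NV N := Sub x xD; have xz : x = val z by rewrite SubK.
move: dx dx'; rewrite xz => dx dx'; apply: (dart_img_inj dx dx').
by apply: (C (k z) _ _ _ (dart_img_in dx) (dart_img_in dx') E); rewrite inE.
Qed.

(** Agreement along the junction makes [psi] on the darts at [k z] a transport of [phiN], also on
    merged edges, where [psi] is defined through [phiP]. *)
Lemma block_glue psi phiP phiN (z : NV N) (T : {set mV (nH N)}) :
  (forall e, psi (jP e) = phiP (val e)) ->
  (forall e, psi (jN e) = phiN (val e)) ->
  {in [:: no1 P; no2 P], forall e, phiP e = phiN (partner P N s e)} ->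
  colouring_off (nD N :|: T) phiN -> val z \notin T ->
  {in darts (k z) &, injective (fun d => psi d.1)}.
Proof.
move=> psiP psiN comp [_ C] zT.
have agree d : d \in darts (val z) -> psi (edge_img d.1) = phiN d.1.
  case: d => e b /dart_kept_or_ni[ke|[ei _]] /=.
    by rewrite (edge_img_Sub ke) psiN.
  by rewrite edge_img_ni // psiP SubK comp ?copartner_no // copartnerK.
rewrite dart_img_darts => _ _ /imsetP[d dz ->] /imsetP[d' dz' ->] /=.
rewrite !agree // => E; congr dart_img; apply: (C (val z)) => //.
by rewrite inE negb_or val_nD.
Qed.

End Block.

(** * Where the ends of kept edges go in the junction *)

Lemma nD_val (N : negdata) (x : mV (nH N)) (z : NV N) :
  x \in nD N -> x = val z -> False.
Proof. by move=> xD E; move: xD; rewrite E; apply/negP; apply: val_nD. Qed.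

Section CompEnd.
Variables (VG : Type) (N Nn : negdata) (s : bool).
Variables (inj : NV N -> VG) (injn : NV Nn -> VG) (c : VG).
Hypotheses (injI : injective inj) (injnI : injective injn).
Hypotheses (inj_injn : forall x y, inj x <> injn y).
Hypotheses (inj_c : forall x, inj x <> c) (injn_c : forall x, injn x <> c).
Hypotheses (hN : is_negator N) (hNn : is_negator Nn).
Local Notation ce := (@comp_end VG N Nn s inj injn c).

Variant comp_end_spec e b : option VG -> Prop :=
| CompEndCentre of mends (nH N) e b = Some (nw N) : comp_end_spec e b (Some c)
| CompEndNext z of mends (nH N) e b = Some (nv N)
    & other_end (partner N Nn s e) (nu Nn) = Some (val z) :
    comp_end_spec e b (Some (injn z))
| CompEndOwn z of mends (nH N) e b = Some (val z) :
    comp_end_spec e b (Some (inj z)).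

(** Kept edges avoid [u], and the far end of an I-edge lies outside the deleted path, so neither use
    of [insub] fails. *)
Lemma comp_endP e b : keepE N e -> comp_end_spec e b (ce e b).
Proof.
move=> ke; rewrite /comp_end; have [x ex] := neg_end hN e b; rewrite ex.
have [E|xw] := eqVneq x (nw N); first by apply: CompEndCentre; rewrite ex E.
have [E|xv] := eqVneq x (nv N).
  have pi := partner_ni Nn s e.
  have /incidentP[c' uc] := ni_u hNn pi.
  have [y yc yD] := ni_end hNn pi uc.
  rewrite (other_endE hNn uc) yc /= insubT /=.
  by apply: CompEndNext; rewrite ?ex ?E // (other_endE hNn uc) yc.
case: insubP => [z zD zx|]; first by apply: CompEndOwn; rewrite ex zx.
rewrite negbK in_nD (negPf xw) (negPf xv) !orbF => /eqP E.
by move: (keepE_u hN ke); rewrite -E (mends_incident ex).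
Qed.

Lemma comp_end_none e b : keepE N e -> ce e b <> None.
Proof. by move=> /comp_endP h; case: h. Qed.

Lemma comp_end_centre e b : keepE N e ->
  ce e b = Some c <-> mends (nH N) e b = Some (nw N).
Proof.
move=> /comp_endP h; case: h => [->//|z ev _|z ez]; split.
- by case=> /injn_c.
- by rewrite ev => -[E]; have := neg_wv hN; rewrite E eqxx.
- by case=> /inj_c.
- by rewrite ez => -[/esym/(nD_val (w_nD N))].
Qed.

Lemma comp_end_next e b z : keepE N e ->
  ce e b = Some (injn z) <->
  mends (nH N) e b = Some (nv N) /\
  other_end (partner N Nn s e) (nu Nn) = Some (val z).
Proof.
move=> /comp_endP h; case: h => [ew|y ev oy|y ey]; split.
- by case=> /esym/injn_c.
- by rewrite ew => -[[E]]; have := neg_wv hN; rewrite E eqxx.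
- by case=> /injnI <-.
- by rewrite oy => -[_ [/val_inj->]].
- by case=> /inj_injn.
- by rewrite ey => -[[/esym/(nD_val (v_nD N))]].
Qed.

Lemma comp_end_own e b z : keepE N e ->
  ce e b = Some (inj z) <-> mends (nH N) e b = Some (val z).
Proof.
move=> /comp_endP h; case: h => [ew|y ev oy|y ey]; split.
- by case=> /esym/inj_c.
- by rewrite ew => -[/(nD_val (w_nD N))].
- by case=> /esym/inj_injn.
- by rewrite ev => -[/(nD_val (v_nD N))].
- by case=> /injI <-.
- by rewrite ey => -[/val_inj->].
Qed.

Lemma comp_end_other e b y : keepE N e -> y <> c ->
  (forall z, y <> inj z) -> (forall z, y <> injn z) -> ce e b <> Some y.
Proof.
move=> /comp_endP h yc yi yn; case: h => [_|z _ _|z _] -[] E.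
- exact: yc.
- exact: (yn z).
- exact: (yi z).
Qed.

End CompEnd.

(** * Colours across a junction and paths inside a block *)

Lemma junctionP (P N : negdata) s phiP phiN : is_negator P ->
  junction s (sig5 P phiP) (sig5 N phiN) <->
  {in [:: no1 P; no2 P], forall e, phiP e = phiN (partner P N s e)}.
Proof.
move=> hP; have o21 : (no2 P == no1 P) = false.
  by rewrite eq_sym (negPf (no_neq hP)).
rewrite /junction /sig5; split=> [|h].
  move=> J e; rewrite !inE => /orP[]/eqP->; rewrite /partner ?eqxx ?o21;
  by case: s J => -[].
have o1 := h (no1 P); have o2 := h (no2 P).
rewrite o1 ?o2 ?inE ?eqxx ?orbT //.
by rewrite /partner eqxx o21; case: (s).
Qed.

(** The block of [P] keeps its O-edge, and the block of [N] sends the partner I-edge to that same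
    merged edge. *)
Lemma edge_img_junction (G : multipole) (Q P N : negdata) s s'
    (jQ : KE Q -> mE G) (jP : KE P -> mE G) (jN : KE N -> mE G) 
    (hQ : is_negator Q) (hP : is_negator P) (hN : is_negator N) e :
  e \in [:: no1 P; no2 P] ->
  edge_img s' jQ jP hQ e = edge_img s jP jN hP (partner P N s e).
Proof.
move=> eo; have ke := keepE_no hP eo.
rewrite (edge_img_Sub _ _ _ _ ke).
by have /= <- := @edge_img_partner G P N s jP jN hP hN (Sub e ke) eo.
Qed.

(** Edges of a path that avoids [nD N] are not in I, so they are kept, and their copies join the
    copies of their ends. *)
Lemma block_connect (G : multipole) (P N : negdata) s jP jN k
    (hN : is_negator N) (B : @block G P N s jP jN k) (x : NV N) y (yD : y \notin nD N) :
  connect (adj_off (N := N)) (val x) y -> connect (adj G) (k x) (k (Sub y yD)).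
Proof.
case/connectP=> p; elim: p x => [|a p IH] x /=.
  by move=> _ E; subst y; rewrite (_ : Sub _ _ = x) //; apply: val_inj; rewrite SubK.
case/andP=> /and3P[/adjP[e [b [h1 h2]]] xD aD] pp yl.
have ke : keepE N e.
  apply: (keepE_end _ h1 xD); apply/negP=> /(ni_u hN)/incidentP[c uc].
  case: (eqVneq c b) => cb.
    by move: h1; rewrite -cb uc => -[E]; case/negP: xD; rewrite -E u_nD.
  have cb' : c = ~~ b by case: c b cb {h1 h2 uc} => -[].
  by move: h2; rewrite -cb' uc => -[E]; case/negP: aD; rewrite -E u_nD.
pose a' : NV N := Sub a aD.
apply: (connect_trans (y := k a')); last exact: IH.
apply: connect1; apply/adjP; exists (jN (Sub e ke)), b.
by split; apply/(block_own B); rewrite SubK.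
Qed.

(** * The graph NNN: its blocks, its centre and gluing of colourings *)

Section NNN.
Variables (N1 N2 N3 : negdata) (s1 s2 s3 : bool).
Hypotheses (h1 : is_negator N1) (h2 : is_negator N2) (h3 : is_negator N3).
Local Notation G := (NNN N1 N2 N3 s1 s2 s3).

Definition k1 (x : NV N1) : mV G := Some (inl (inl x)).
Definition k2 (x : NV N2) : mV G := Some (inl (inr x)).
Definition k3 (x : NV N3) : mV G := Some (inr x).
Definition centre : mV G := None.
Definition j1 (e : KE N1) : mE G := inl (inl e).
Definition j2 (e : KE N2) : mE G := inl (inr e).
Definition j3 (e : KE N3) : mE G := inr e.

Lemma k1_inj : injective k1. Proof. by move=> x y []. Qed.
Lemma k2_inj : injective k2. Proof. by move=> x y []. Qed.
Lemma k3_inj : injective k3. Proof. by move=> x y []. Qed.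
Lemma j1_inj : injective j1. Proof. by move=> x y []. Qed.
Lemma j2_inj : injective j2. Proof. by move=> x y []. Qed.
Lemma j3_inj : injective j3. Proof. by move=> x y []. Qed.

Lemma mends_NNN1 (e : KE N1) b :
  mends G (j1 e) b = comp_end _ N1 N2 s1 k1 k2 centre (val e) b.
Proof. by []. Qed.

Lemma mends_NNN2 (e : KE N2) b :
  mends G (j2 e) b = comp_end _ N2 N3 s2 k2 k3 centre (val e) b.
Proof. by []. Qed.

Lemma mends_NNN3 (e : KE N3) b :
  mends G (j3 e) b = comp_end _ N3 N1 s3 k3 k1 centre (val e) b.
Proof. by []. Qed.

Lemma block1 : block s3 j3 j1 k1.
Proof.
split; [exact: j3_inj|exact: j1_inj|by []|..].
- move=> e b z; rewrite mends_NNN1.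
  by apply: (comp_end_own _ k1_inj _ _ h1 h2 _ _ (valP e)).
- move=> e b z; rewrite mends_NNN3.
  by apply: (comp_end_next _ k1_inj _ _ h3 h1 _ _ (valP e)).
- case=> [[e|e]|e] b z; [by left; exists e| |by right; exists e].
  by rewrite mends_NNN2 => /(comp_end_other h2 h3 (valP e)); case.
Qed.

Lemma block2 : block s1 j1 j2 k2.
Proof.
split; [exact: j1_inj|exact: j2_inj|by []|..].
- move=> e b z; rewrite mends_NNN2.
  by apply: (comp_end_own _ k2_inj _ _ h2 h3 _ _ (valP e)).
- move=> e b z; rewrite mends_NNN1.
  by apply: (comp_end_next _ k2_inj _ _ h1 h2 _ _ (valP e)).
- case=> [[e|e]|e] b z; [by right; exists e|by left; exists e|].
  by rewrite mends_NNN3 => /(comp_end_other h3 h1 (valP e)); case.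
Qed.

Lemma block3 : block s2 j2 j3 k3.
Proof.
split; [exact: j2_inj|exact: j3_inj|by []|..].
- move=> e b z; rewrite mends_NNN3.
  by apply: (comp_end_own _ k3_inj _ _ h3 h1 _ _ (valP e)).
- move=> e b z; rewrite mends_NNN2.
  by apply: (comp_end_next _ k3_inj _ _ h2 h3 _ _ (valP e)).
- case=> [[e|e]|e] b z; [|by right; exists e|by left; exists e].
  by rewrite mends_NNN1 => /(comp_end_other h1 h2 (valP e)); case.
Qed.

Definition r1 : KE N1 := Sub (nr N1) (keepE_nr h1).
Definition r2 : KE N2 := Sub (nr N2) (keepE_nr h2).
Definition r3 : KE N3 := Sub (nr N3) (keepE_nr h3).

Lemma mends_centre1 e b :
  mends G (j1 e) b = Some centre <-> mends (nH N1) (val e) b = Some (nw N1).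
Proof. by rewrite mends_NNN1; apply: (comp_end_centre _ _ _ h1 h2 _ (valP e)). Qed.

Lemma mends_centre2 e b :
  mends G (j2 e) b = Some centre <-> mends (nH N2) (val e) b = Some (nw N2).
Proof. by rewrite mends_NNN2; apply: (comp_end_centre _ _ _ h2 h3 _ (valP e)). Qed.

Lemma mends_centre3 e b :
  mends G (j3 e) b = Some centre <-> mends (nH N3) (val e) b = Some (nw N3).
Proof. by rewrite mends_NNN3; apply: (comp_end_centre _ _ _ h3 h1 _ (valP e)). Qed.

(** In each negator [r] is the only kept edge at [w], and ends at [w] are exactly those moved to the
    centre. *)
Lemma centre_darts : exists b1 b2 b3,
  darts centre = [set (j1 r1, b1); (j2 r2, b2); (j3 r3, b3)].
Proof.
have [/incidentP[b1 w1] /incidentP[b2 w2] /incidentP[b3 w3]] :=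
  And3 (nr_w h1) (nr_w h2) (nr_w h3).
exists b1, b2, b3; apply/eqP; rewrite eqEsubset; apply/andP; split; last first.
  apply/subsetP=> d; rewrite !inE => /orP[/orP[]|] /eqP->; apply/eqP.
  - exact/mends_centre1.
  - exact/mends_centre2.
  - exact/mends_centre3.
apply/subsetP=> -[[[e|e]|e] b]; rewrite in_darts => /eqP.
- move/mends_centre1 => ew.
  have E : e = r1 by apply: val_inj; apply: (keepE_w h1 (valP e) (mends_incident ew)).
  by subst e; rewrite (neg_dart_inj h1 ew w1) !inE eqxx.
- move/mends_centre2 => ew.
  have E : e = r2 by apply: val_inj; apply: (keepE_w h2 (valP e) (mends_incident ew)).
  by subst e; rewrite (neg_dart_inj h2 ew w2) !inE eqxx orbT.
- move/mends_centre3 => ew.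
  have E : e = r3 by apply: val_inj; apply: (keepE_w h3 (valP e) (mends_incident ew)).
  by subst e; rewrite (neg_dart_inj h3 ew w3) !inE eqxx !orbT.
Qed.

Lemma NNN_cubic_graph : cubic_graph G.
Proof.
split; last first.
  case=> [[e|e]|e] b; apply/eqP.
  - exact: (comp_end_none h1 h2 (valP e)).
  - exact: (comp_end_none h2 h3 (valP e)).
  - exact: (comp_end_none h3 h1 (valP e)).
case=> [[[z|z]|z]|].
- exact: (block_cubic h3 h1 block1).
- exact: (block_cubic h1 h2 block2).
- exact: (block_cubic h2 h3 block3).
- have [b1 [b2 [b3 E]]] := centre_darts.
  by rewrite -/(darts centre) E setUC !cardsU1 cards1 !inE.
Qed.

(** The three colourings agree on merged edges, so together they colour all edges; [S] contains
    every vertex where properness may fail. *)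
Lemma NNN_glue (S : {set mV G}) T1 T2 T3 del :
  cyclic_colouring s1 s2 s3 T1 T2 T3 del ->
  (forall z, val z \in T1 -> k1 z \in S) ->
  (forall z, val z \in T2 -> k2 z \in S) ->
  (forall z, val z \in T3 -> k3 z \in S) ->
  (del -> centre \in S) ->
  colourable (delete G S).
Proof.
case=> t1 [t2 [t3 [[[phi1 c1 <-] [phi2 c2 <-] [phi3 c3 <-]]]]].
case=> -[/(junctionP _ _ _ h1) J1 /(junctionP _ _ _ h2) J2 /(junctionP _ _ _ h3) J3].
move=> U S1 S2 S3 Sc.
pose psi (e : mE G) : col := match e with
  | inl (inl e) => phi1 (val e) | inl (inr e) => phi2 (val e)
  | inr e => phi3 (val e) end.
exists psi; apply/colouring_delete; split.
  by case=> [[e|e]|e]; [apply: c1.1|apply: c2.1|apply: c3.1].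
case=> [[[z|z]|z]|] zS.
- apply: (@block_glue _ _ _ _ _ _ _ h3 h1 block1 _ phi3 phi1 z T1) => //.
  by apply: contra zS; apply: S1.
- apply: (@block_glue _ _ _ _ _ _ _ h1 h2 block2 _ phi1 phi2 z T2) => //.
  by apply: contra zS; apply: S2.
- apply: (@block_glue _ _ _ _ _ _ _ h2 h3 block3 _ phi2 phi3 z T3) => //.
  by apply: contra zS; apply: S3.
have [b1 [b2 [b3 E]]] := centre_darts.
have {U} : uniq [:: phi1 (nr N1); phi2 (nr N2); phi3 (nr N3)].
  by case/orP: U => // /Sc cS; rewrite cS in zS.
rewrite /= !inE negb_or andbT => /andP[/andP[/negP n12 /negP n13] /negP n23].
rewrite E => d d'; rewrite !inE => /orP[/orP[]|] /eqP-> /orP[/orP[]|] /eqP-> //= /eqP;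
  by rewrite // eq_sym.
Qed.

(** * No colouring, and connectedness *)

Hypotheses (p1 : perfect N1) (p2 : perfect N2) (p3 : perfect N3).

(** A colouring would restrict to three perfect signatures joined in a cycle. *)
Lemma NNN_uncolourable : ~ colourable G.
Proof.
case=> psi /colouring_off0 c.
have c1 := block_restrict h3 h1 block1 c.
have c2 := block_restrict h1 h2 block2 c.
have c3 := block_restrict h2 h3 block3 c.
apply: (perfect_cycle (s1 := s1) (s2 := s2) (s3 := s3)
  (perfect_sig5 p1 c1) (perfect_sig5 p2 c2) (perfect_sig5 p3 c3)).
- by apply/junctionP => // e eo; congr psi; apply: edge_img_junction.
- by apply/junctionP => // e eo; congr psi; apply: edge_img_junction.
- by apply/junctionP => // e eo; congr psi; apply: edge_img_junction.
Qed.

Lemma block_connect_centre P N s jP jN k (hN : is_negator N) (pN : perfect N)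
    (B : @block G P N s jP jN k) :
  (forall e b, mends G (jN e) b = Some centre <->
     mends (nH N) (val e) b = Some (nw N)) ->
  forall z, connect (adj G) (k z) centre.
Proof.
move=> jc z.
have [x [xD rx /(block_connect hN B xD) zx]] :=
  connect_to_nr hN pN (val_nD z).
apply: connect_trans zx (connect1 _); apply/adjP.
have xw : x != nw N by apply: contraNneq xD => ->; apply: w_nD.
have [b [bx bw]] := incident_both xw rx (nr_w hN).
exists (jN (Sub (nr N) (keepE_nr hN))), b.
by split; [apply/(block_own B)|apply/jc]; rewrite !SubK.
Qed.

Lemma NNN_connected : connected G.
Proof.
have toc x : connect (adj G) x centre.
  case: x => [[[z|z]|z]|]; last exact: connect0.
  - exact: (block_connect_centre h1 p1 block1 mends_centre1).
  - exact: (block_connect_centre h2 p2 block2 mends_centre2).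
  - exact: (block_connect_centre h3 p3 block3 mends_centre3).
move=> x y; apply: connect_trans (toc x) _.
by rewrite (sym_connect_sym (@adj_sym G)).
Qed.

(** * Bicriticality *)

Hypotheses (f1 : feasible N1) (f2 : feasible N2) (f3 : feasible N3).

(** Any two of three negators are consecutive on the cycle. Up to rotation and exchange of [x] and
    [y], the cases are therefore: one negator, two consecutive negators, or the centre and a
    negator. *)
Lemma NNN_bicritical (x y : mV G) : x != y -> colourable (delete G [set x; y]).
Proof.
have in1 (a b z : NV N1) : val z \in [set val a; val b] -> k1 z \in [set k1 a; k1 b].
  by rewrite !inE => /orP[]/eqP/val_inj->; rewrite eqxx ?orbT.
have in2 (a b z : NV N2) : val z \in [set val a; val b] -> k2 z \in [set k2 a; k2 b].
  by rewrite !inE => /orP[]/eqP/val_inj->; rewrite eqxx ?orbT.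
have in3 (a b z : NV N3) : val z \in [set val a; val b] -> k3 z \in [set k3 a; k3 b].
  by rewrite !inE => /orP[]/eqP/val_inj->; rewrite eqxx ?orbT.
have cen1 z : colourable (delete G [set centre; k1 z]).
  by apply: (NNN_glue (cyclic_colouring_centre s1 s2 s3 f1 p2 p3 z))
    => // a; rewrite !inE //.
have cen2 z : colourable (delete G [set centre; k2 z]).
  by apply: (NNN_glue (cyclic_colouring_rot
      (cyclic_colouring_centre s2 s3 s1 f2 p3 p1 z)))
    => // a; rewrite !inE //.
have cen3 z : colourable (delete G [set centre; k3 z]).
  by apply: (NNN_glue (cyclic_colouring_rot (cyclic_colouring_rot
      (cyclic_colouring_centre s3 s1 s2 f3 p1 p2 z))))
    => // a; rewrite !inE //.
have nx1 a b : colourable (delete G [set k1 a; k2 b]).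
  apply: (NNN_glue (cyclic_colouring_next s1 s2 s3 h1 f1 f2 p3 a b))
    => // z; rewrite !inE // => h.
  by apply/orP; left.
have nx2 a b : colourable (delete G [set k2 a; k3 b]).
  apply: (NNN_glue (cyclic_colouring_rot
      (cyclic_colouring_next s2 s3 s1 h2 f2 f3 p1 a b)))
    => // z; rewrite !inE // => h.
  by apply/orP; left.
have nx3 a b : colourable (delete G [set k3 a; k1 b]).
  apply: (NNN_glue (cyclic_colouring_rot (cyclic_colouring_rot
      (cyclic_colouring_next s3 s1 s2 h3 f3 f1 p2 a b))))
    => // z; rewrite !inE // => h.
  by apply/orP; left.
have sy a b : colourable (delete G [set a; b]) -> colourable (delete G [set b; a]).
  by rewrite setUC.
case: x y => [[[a|a]|a]|] [[[b|b]|b]|] ab //.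
- apply: (NNN_glue (cyclic_colouring_same s1 s2 s3 h1 f1 p2 p3 (ab : a != b)))
    => // z.
  + exact: in1.
  + by rewrite inE.
  + by rewrite inE.
- exact: nx1.
- by apply: sy; apply: nx3.
- by apply: sy; apply: cen1.
- by apply: sy; apply: nx1.
- apply: (NNN_glue (cyclic_colouring_rot
      (cyclic_colouring_same s2 s3 s1 h2 f2 p3 p1 (ab : a != b))))
    => // z.
  + by rewrite inE.
  + exact: in2.
  + by rewrite inE.
- exact: nx2.
- by apply: sy; apply: cen2.
- exact: nx3.
- by apply: sy; apply: nx2.
- apply: (NNN_glue (cyclic_colouring_rot (cyclic_colouring_rot
      (cyclic_colouring_same s3 s1 s2 h3 f3 p1 p2 (ab : a != b)))))
    => // z.
  + by rewrite inE.
  + by rewrite inE.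
  + exact: in3.
- by apply: sy; apply: cen3.
- exact: cen1.
- exact: cen2.
- exact: cen3.
Qed.

End NNN.

Theorem theorem15 (N1 N2 N3 : negdata) (s1 s2 s3 : bool) :
  is_negator N1 -> is_negator N2 -> is_negator N3 ->
  feasible N1 -> feasible N2 -> feasible N3 ->
  perfect N1 -> perfect N2 -> perfect N3 ->
  bicritical_snark (NNN N1 N2 N3 s1 s2 s3).
Proof.
move=> h1 h2 h3 f1 f2 f3 p1 p2 p3; split; last exact: NNN_bicritical.
split; [exact: NNN_cubic_graph|split].
  exact: NNN_connected.
exact: NNN_uncolourable.
Qed.
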